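(* Let $n\ge 1$, $p\in\{1,\dots,n\}$ and $k\ge 0$ be integers, let $A_0,A_1,\dots,A_k\in\mathbb{R}^{p\times n}$, and let $a_i^l\in\mathbb{R}\cup\{-\infty\}$, $a_i^u\in\mathbb{R}\cup\{+\infty\}$ for $i=1,\dots,k$. If $p\le n-k$, then the semidefinite relaxation (SDR) of the linear program on the Stiefel manifold (LPS) is exact, i.e. $v(\mathrm{SDR})=v(\mathrm{LPS})$.
   Context: $\mathrm{tr}(\cdot)$ is the trace, $I_m$ the identity matrix of order $m$, $0_m$ the $m\times m$ zero matrix, $\mathbb{S}^{m}$ the set of real symmetric $m\times m$ matrices, and $Y\succeq 0$ means $Y$ is positive semidefinite. For an optimization problem $(P)$, $v(P)$ denotes its optimal value (with $v(P)=+\infty$ if a minimization problem is infeasible). For $Y\in\mathbb{S}^{n+p}$, $Y_{[1:n]}$ denotes the leading $n\times n$ principal submatrix (rows and columns $1,\dots,n$) and $Y_{[n+1:n+p]}$ the principal submatrix with rows and columns $n+1,\dots,n+p$. The Stiefel manifold is $St_{n,p}=\{X\in\mathbb{R}^{n\times p}: X^TX=I_p\}$. Problem (LPS): minimize $\mathrm{tr}(A_0X)$ over $X\in E_{n,p,k}=\{X\in St_{n,p}: a_i^l\le \mathrm{tr}(A_iX)\le a_i^u,\ i=1,\dots,k\}$. Problem (SDR): minimize $\mathrm{tr}(B_0Y)$ over $Y\in\mathbb{S}^{n+p}$ subject to $a_i^l\le\mathrm{tr}(B_iY)\le a_i^u$ for $i=1,\dots,k$, $Y_{[1:n]}=I_n$,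 $Y_{[n+1:n+p]}=I_p$, and $Y\succeq 0$, where $B_i=\frac12\begin{bmatrix}0_n & A_i^T\\ A_i & 0_p\end{bmatrix}$ for $i=0,1,\dots,k$. *)

(* Defs.v *)
From mathcomp Require Import all_boot all_order all_algebra.
From mathcomp Require Import classical_sets reals ereal.

Set Implicit Arguments.
Unset Strict Implicit.
Unset Printing Implicit Defensive.

Import Order.TTheory GRing.Theory Num.Theory.

Local Open Scope classical_set_scope.
Local Open Scope ring_scope.

(* As an infimum in [\bar R], the value of an infeasible problem is [+oo]. *)
Definition optimal_value (R : realType) (T : Type) (F : set T) (f : T -> R)
  : \bar R := ereal_inf [set (f x)%:E | x in F].

(* Symmetry is not part of [psd]: it is required in [SDR_feasible]. *)
Definition psd (R : realType) (m : nat) (Y : 'M[R]_m) : Prop :=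
  forall x : 'cV[R]_m, 0 <= (x^T *m Y *m x) 0 0.

Definition stiefel (R : realType) (n p : nat) : set 'M[R]_(n, p) :=
  [set X | X^T *m X = 1%:M].
Arguments stiefel : clear implicits.

Definition LPS_feasible (R : realType) (n p k : nat)
    (A : 'I_k -> 'M[R]_(p, n)) (al au : 'I_k -> \bar R) : set 'M[R]_(n, p) :=
  [set X | stiefel R n p X /\
    forall i, (al i <= (\tr (A i *m X))%:E <= au i)%E].

Definition LPS_value (R : realType) (n p k : nat) (A0 : 'M[R]_(p, n))
    (A : 'I_k -> 'M[R]_(p, n)) (al au : 'I_k -> \bar R) : \bar R :=
  optimal_value (LPS_feasible A al au) (fun X => \tr (A0 *m X)).

Definition lift_mx (R : realType) (n p : nat) (A : 'M[R]_(p, n))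
  : 'M[R]_(n + p) := 2^-1 *: block_mx 0 A^T A 0.

Definition SDR_feasible (R : realType) (n p k : nat)
    (A : 'I_k -> 'M[R]_(p, n)) (al au : 'I_k -> \bar R) : set 'M[R]_(n + p) :=
  [set Y | [/\ Y^T = Y,
    forall i, (al i <= (\tr (lift_mx (A i) *m Y))%:E <= au i)%E,
    ulsubmx Y = 1%:M,
    drsubmx Y = 1%:M
    & psd Y]].

Definition SDR_value (R : realType) (n p k : nat) (A0 : 'M[R]_(p, n))
    (A : 'I_k -> 'M[R]_(p, n)) (al au : 'I_k -> \bar R) : \bar R :=
  optimal_value (SDR_feasible A al au) (fun Y => \tr (lift_mx A0 *m Y)).

(* Main.v *)
Require Import Defs.
From mathcomp Require Import all_boot all_order all_algebra.
From mathcomp Require Import classical_sets reals ereal.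
From mathcomp Require Import ring lra.

(** Apart from the trace constraints, the relaxation ranges over the symmetric
    block matrices with identity diagonal blocks and off-diagonal block [X]
    whose Schur complement [M := 1 - X^T X] is positive semidefinite, i.e. over
    the contractions [X]; on the Stiefel manifold [M = 0].  Both problems see
    [X] only through the numbers [tr (A_i X)] ([lift_mx_trace]).  The relaxation
    is exact because every contraction [X] can be moved to the manifold while
    all [tr (A_i X)] with [i >= 1] are kept and [tr (A_0 X)] does not increase
    ([contraction_to_stiefel]).

    The move is a sequence of rank-one updates.  Let [M i i > 0] and let [v] be
    column [i] of [M].  The unknowns [(w, c)] of the homogeneous system
    [X^T w = c v], [tr (A_j w v^T) = 0] for [j = 1, ..., k], number [n + 1],
    and there are [p + k <= n] equations; so a nonzero solution exists, and it
    has [w <> 0] because [v <> 0] ([update_direction]).  Along [X + t w v^T]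
    the defect is [M - (2 t c + t^2 |w|^2) v v^T].  The quadratic in [t] takes
    the value [1 / M i i] at a nonnegative [t], and [w] may be replaced by
    [- w], which orients the move so that the objective does not increase.
    With that [t] the new defect is [M] after one step of Cholesky elimination:
    it is again positive semidefinite ([psd_eliminate]), its row [i] vanishes,
    and its rows that vanished before still do.  After at most [p] updates the
    diagonal of the defect is zero, and a positive semidefinite matrix with
    zero diagonal is zero ([psd_diag0]).  The objective being linear, neither
    compactness nor extreme points are involved, so the argument also covers
    infeasible problems. *)

Set Implicit Arguments.
Unset Strict Implicit.
Unset Printing Implicit Defensive.

Import Order.TTheory GRing.Theory Num.Theory.

Local Open Scope ring_scope.

(** * Linear algebra over a real field *)

Lemma underdetermined_kernel (F : fieldType) (m q : nat) (B : 'M[F]_(m, q)) :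
  (q < m)%N -> exists2 u : 'rV[F]_m, u != 0 & u *m B = 0.
Proof.
move=> ltqm; have : kermx B != 0.
  rewrite -mxrank_eq0 mxrank_ker -lt0n subn_gt0.
  exact: leq_ltn_trans (rank_leq_col B) ltqm.
move=> /rowV0Pn[u /sub_kermxP uB u0]; by exists u.
Qed.

Lemma dot_gt0 (R : realType) (m : nat) (w : 'cV[R]_m) :
  w != 0 -> 0 < (w^T *m w) 0 0.
Proof.
move=> w0; rewrite lt_neqAle eq_sym.
have E : (w^T *m w) 0 0 = \sum_j w j 0 ^+ 2.
  by rewrite mxE; apply: eq_bigr => j _; rewrite mxE.
rewrite E sumr_ge0 ?andbT; last by move=> j _; apply: sqr_ge0.
apply: contra w0 => /eqP/psumr_eq0P h; apply/eqP/colP => j; rewrite mxE.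
by apply/eqP; rewrite -sqrf_eq0 h // => l _; apply: sqr_ge0.
Qed.

Lemma dot_ge0 (R : realType) (m : nat) (w : 'cV[R]_m) : 0 <= (w^T *m w) 0 0.
Proof.
have [->|/dot_gt0/ltW//] := eqVneq w 0.
by rewrite mulmx0 mxE.
Qed.

Lemma quadratic_nonneg_root (R : realType) (a c s : R) : 0 < a -> 0 < s ->
  exists2 t, 0 <= t & 2 * t * c + t ^+ 2 * a = s.
Proof.
move=> a0 s0; set d := c ^+ 2 + s * a.
have d0 : 0 <= d by rewrite addr_ge0 ?sqr_ge0 // mulr_ge0 // ltW.
exists ((Num.sqrt d - c) / a).
  rewrite divr_ge0 ?(ltW a0) // subr_ge0 (le_trans (ler_norm c)) //.
  by rewrite -sqrtr_sqr ler_wsqrtr // lerDl mulr_ge0 // ltW.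
have Hd := sqr_sqrtr d0.
have -> : 2 * ((Num.sqrt d - c) / a) * c + ((Num.sqrt d - c) / a) ^+ 2 * a
   = (Num.sqrt d ^+ 2 - c ^+ 2) / a by field; rewrite gt_eqF.
by rewrite Hd /d addrAC subrr add0r mulfK // gt_eqF.
Qed.

(** * Positive semidefinite matrices *)

Lemma delta_form (R : realType) (m : nat) (M : 'M[R]_m) (i j : 'I_m) :
  (delta_mx i 0 : 'cV[R]_m)^T *m M *m delta_mx j 0 = (M i j)%:M.
Proof.
have -> : (delta_mx i 0 : 'cV[R]_m)^T = delta_mx 0 i by exact: trmx_delta.
by rewrite -rowE -colE [LHS]mx11_scalar !mxE.
Qed.

Lemma psd_diag_ge0 (R : realType) (m : nat) (M : 'M[R]_m) (i : 'I_m) :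
  psd M -> 0 <= M i i.
Proof.
by move=> /(_ (delta_mx i 0)); rewrite delta_form mxE.
Qed.

(** A nonzero [M i j] would make the quadratic form negative at
    [t e_i + e_j] for suitable [t], since it is affine in [t] there. *)
Lemma psd_diag0 (R : realType) (m : nat) (M : 'M[R]_m) (i j : 'I_m) :
  M^T = M -> psd M -> M i i = 0 -> M i j = 0.
Proof.
move=> Ms Mp Mi0; apply/eqP/negP => /negP Mij.
have Mji : M j i = M i j by rewrite -{1}Ms mxE.
pose t : R := - (M j j + 1) / (2 * M i j).
have := Mp (t *: delta_mx i 0 + delta_mx j 0).
rewrite [(_ + _)^T]linearD /= [(t *: _)^T]linearZ /= !mulmxDl !mulmxDr.
rewrite -!scalemxAr -!scalemxAl.
rewrite !delta_form !mxE Mi0 Mji !mulr1n.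
suff -> : t * (t * 0) + t * M i j + (t * M i j + M j j) = -1 by lra.
by rewrite /t; field.
Qed.

(** The deflated form at [x] is the form of [M] at the component
    [y := x - (z^T M x / z^T M z) z] of [x] that is [M]-orthogonal to [z]. *)
Lemma psd_deflate (R : realType) (m : nat) (M : 'M[R]_m) (z : 'cV[R]_m) :
  M^T = M -> psd M -> (z^T *m M *m z) 0 0 != 0 ->
  psd (M - ((z^T *m M *m z) 0 0)^-1 *: (M *m z *m (M *m z)^T)).
Proof.
move=> Ms Mp; set q := (z^T *m M *m z) 0 0 => q0 x.
set b := (z^T *m M *m x) 0 0.
have bE : z^T *m M *m x = b%:M by rewrite [LHS]mx11_scalar.
have bE' : x^T *m M *m z = b%:M.
  rewrite -[LHS]trmxK (_ : (x^T *m M *m z)^T = z^T *m M *m x).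
    by rewrite bE tr_scalar_mx.
  by rewrite !trmx_mul trmxK Ms mulmxA.
have qE : z^T *m M *m z = q%:M by rewrite [LHS]mx11_scalar.
have := Mp (x - (b / q) *: z).
suff -> : (x - (b / q) *: z)^T *m M *m (x - (b / q) *: z) =
  x^T *m (M - q^-1 *: (M *m z *m (M *m z)^T)) *m x by [].
rewrite trmx_mul Ms [(_ - _)^T]linearB /= [(_ *: z)^T]linearZ /=.
rewrite !mulmxBl !mulmxBr mulmxBl.
rewrite -!scalemxAl -!scalemxAr -!scalemxAl !mulmxA bE bE' qE.
rewrite -!mulmxA [z^T *m (M *m x)]mulmxA bE -scalar_mxM.
apply/matrixP => a c; rewrite !ord1 !mxE !eqxx !mulr1n.
by field.
Qed.

Lemma psd_eliminate (R : realType) (m : nat) (M : 'M[R]_m) (i : 'I_m) :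
  M^T = M -> psd M -> M i i != 0 ->
  psd (M - (M i i)^-1 *: (col i M *m (col i M)^T)).
Proof.
move=> Ms Mp Mi; have := psd_deflate Ms Mp (z := delta_mx i 0).
by rewrite delta_form mxE -colE; apply.
Qed.

(** * Moving a contraction to the Stiefel manifold *)

Section Update.
Variables (R : realType) (n p k : nat).
Variable A : 'I_k -> 'M[R]_(p, n).

(** The Schur complement of the leading identity block in the block matrix of
    the relaxation; [X] is a contraction when it is positive semidefinite. *)
Definition defect (X : 'M[R]_(n, p)) : 'M[R]_p := 1%:M - X^T *m X.

Lemma defect_sym (X : 'M[R]_(n, p)) : (defect X)^T = defect X.
Proof. by rewrite /defect linearB /= trmx_mul trmxK trmx1. Qed.

Lemma mxtrace_rank1 (B : 'M[R]_(p, n)) (w : 'cV[R]_n) (v : 'cV[R]_p) :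
  \tr (B *m (w *m v^T)) = (v^T *m B *m w) 0 0.
Proof. by rewrite mulmxA mxtrace_mulC mulmxA [LHS]trace_mx11. Qed.

Lemma update_direction (X : 'M[R]_(n, p)) (v : 'cV[R]_p) :
  v != 0 -> (p + k <= n)%N ->
  exists w : 'cV[R]_n, exists c : R,
    [/\ w != 0, X^T *m w = c *: v &
        forall j, \tr (A j *m (w *m v^T)) = 0].
Proof.
move=> v0 hpk.
pose W := \matrix_(a < n, j < k) (v^T *m A j) 0 a.
have [|u u0] := underdetermined_kernel
    (col_mx (row_mx X W) (row_mx (- v^T) (0 : 'M_(1, k)))).
  by rewrite addn1 ltnS.
rewrite -[u in u *m _]hsubmxK mul_row_col !mul_mx_row add_row_mx.
rewrite mulmx0 addr0 -[0]row_mx0 => /eq_row_mx[EX EW].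
set w := lsubmx u in EX EW; set c := rsubmx u in EX EW.
have cE : c = (c 0 0)%:M by rewrite [LHS]mx11_scalar.
have Xw : w *m X = c 0 0 *: v^T.
  by apply/eqP; rewrite -subr_eq0 -mul_scalar_mx -cE -mulmxN EX.
exists w^T, (c 0 0); split.
- apply: contra u0; rewrite trmx_eq0 => /eqP w0.
  move: Xw; rewrite w0 mul0mx => /esym/eqP.
  rewrite scaler_eq0 trmx_eq0 (negPf v0) orbF => /eqP c0.
  by rewrite -[u]hsubmxK -/w -/c w0 cE c0 raddf0 row_mx0.
- by rewrite -trmx_mul Xw linearZ /= trmxK.
- move=> j; rewrite mxtrace_rank1.
  move/matrixP/(_ 0 j): EW; rewrite !mxE => EW.
  rewrite -[RHS]EW; apply: eq_bigr => a _.
  by rewrite [W _ _]mxE [_^T _ _]mxE mulrC.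
Qed.

Lemma defect_update (X : 'M[R]_(n, p)) (w : 'cV[R]_n) (v : 'cV[R]_p) (c t : R) :
  X^T *m w = c *: v ->
  defect (X + t *: (w *m v^T)) =
  defect X - (2 * t * c + t ^+ 2 * (w^T *m w) 0 0) *: (v *m v^T).
Proof.
move=> Xw; have wX : w^T *m X = c *: v^T.
  by rewrite -[LHS]trmxK trmx_mul trmxK Xw linearZ.
have ww : w^T *m w = ((w^T *m w) 0 0)%:M by rewrite [LHS]mx11_scalar.
rewrite /defect [(_ + _)^T]linearD /= [(t *: _)^T]linearZ /= trmx_mul trmxK.
rewrite mulmxDl !mulmxDr -!scalemxAl -!scalemxAr !mulmxA Xw.
rewrite -(mulmxA v) wX -(mulmxA v w^T w) {1}ww mul_mx_scalar.
rewrite -!scalemxAl -!scalemxAr.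
apply/matrixP => a b; rewrite !mxE; ring.
Qed.

Variable A0 : 'M[R]_(p, n).

Lemma elimination_step (X : 'M[R]_(n, p)) (i : 'I_p) :
  (p + k <= n)%N -> psd (defect X) -> defect X i i != 0 ->
  exists X' : 'M[R]_(n, p),
    [/\ forall j, \tr (A j *m X') = \tr (A j *m X),
        \tr (A0 *m X') <= \tr (A0 *m X) &
        defect X' = defect X -
          (defect X i i)^-1 *: (col i (defect X) *m (col i (defect X))^T)].
Proof.
move=> hpk Mp Mi; set v := col i (defect X).
have Mi0 : 0 < defect X i i by rewrite lt_neqAle eq_sym Mi psd_diag_ge0.
have v0 : v != 0.
  by apply: contra Mi => /eqP/colP/(_ i); rewrite !mxE => ->.
(* Negating [w] and [c] together preserves the system. *)
have [w [c [w0 Xw Aw A0w]]] : exists w : 'cV[R]_n, exists c : R,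
    [/\ w != 0, X^T *m w = c *: v,
        forall j, \tr (A j *m (w *m v^T)) = 0 &
        \tr (A0 *m (w *m v^T)) <= 0].
  have [w [c [w0 Xw Aw]]] := update_direction X v0 hpk.
  have [le0|/ltW ge0] := lerP (\tr (A0 *m (w *m v^T))) 0.
    by exists w, c.
  exists (- w), (- c); split.
  - by rewrite oppr_eq0.
  - by rewrite mulmxN Xw scaleNr.
  - by move=> j; rewrite mulNmx mulmxN raddfN /= Aw oppr0.
  - by rewrite mulNmx mulmxN raddfN /= oppr_le0.
(* This value of the quadratic makes the update subtract exactly the
   Cholesky term of pivot [i]. *)
have [t t0 tE] : exists2 t, 0 <= t &
    2 * t * c + t ^+ 2 * (w^T *m w) 0 0 = (defect X i i)^-1.
  by apply: quadratic_nonneg_root; rewrite ?dot_gt0 ?invr_gt0.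
have trE B : \tr (B *m (X + t *: (w *m v^T))) =
    \tr (B *m X) + t * \tr (B *m (w *m v^T)).
  by rewrite mulmxDr -scalemxAr linearD linearZ.
exists (X + t *: (w *m v^T)); split.
- by move=> j; rewrite trE Aw mulr0 addr0.
- by rewrite trE gerDl mulr_ge0_le0.
- by rewrite (defect_update _ Xw) tE.
Qed.

(** Induction on the number of nonzero diagonal entries of the defect.  An
    elimination step at [i] clears entry [i], and keeps a zero entry [l]
    zero because row [l] of the defect, hence entry [l] of its column [i],
    vanishes. *)
Lemma contraction_to_stiefel (X : 'M[R]_(n, p)) :
  (p + k <= n)%N -> psd (defect X) ->
  exists X' : 'M[R]_(n, p),
    [/\ stiefel R n p X', forall j, \tr (A j *m X') = \tr (A j *m X) &
        \tr (A0 *m X') <= \tr (A0 *m X)].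
Proof.
move=> hpk.
have [d] := ubnP #|[set i | defect X i i != 0]|.
elim: d X => // d IH X; rewrite ltnS => cardX Mp.
have [i Mi|diag0] := pickP [pred i | defect X i i != 0]; last first.
  exists X; split=> //; apply/esym/eqP; rewrite -subr_eq0; apply/eqP/matrixP.
  move=> i j; rewrite [RHS]mxE; apply: psd_diag0 => //; first exact: defect_sym.
  by apply/eqP/negPn; have /= -> := diag0 i.
have [X1 [trA trA0 M1]] := elimination_step hpk Mp Mi.
have M1p : psd (defect X1).
  by rewrite M1; apply: psd_eliminate => //; apply: defect_sym.
have M1E l : defect X1 l l =
    defect X l l - (defect X i i)^-1 * (defect X l i * defect X l i).
  by rewrite M1 !mxE big_ord1 !mxE.
have card1 : (#|[set l | defect X1 l l != 0%R]| < d)%N.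
  apply: leq_trans cardX; apply: proper_card; apply/properP; split.
    apply/fintype.subsetP => l; rewrite !inE; apply: contra => /eqP Ml0.
    by rewrite M1E (@psd_diag0 _ _ _ l i (defect_sym X)) ?Ml0 ?mulr0 ?subrr.
  by exists i; rewrite !inE // M1E mulKf // subrr eqxx.
have [X' [X'S trA' trA0']] := IH X1 card1 M1p.
exists X'; split=> // [j|]; first by rewrite trA' trA.
exact: le_trans trA0' trA0.
Qed.

End Update.

(** * Block matrices of the relaxation *)

Lemma lift_mx_trace (R : realType) (n p : nat) (B : 'M[R]_(p, n))
    (Y : 'M[R]_(n + p)) :
  Y^T = Y -> \tr (lift_mx B *m Y) = \tr (B *m ursubmx Y).
Proof.
move=> Ys; have dl : dlsubmx Y = (ursubmx Y)^T by rewrite trmx_ursub Ys.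
rewrite /lift_mx -scalemxAl -[Y in LHS]submxK mulmx_block mxtraceZ.
rewrite mxtrace_block !mul0mx add0r addr0 dl -trmx_mul mxtrace_tr.
rewrite [\tr (ursubmx Y *m B)]mxtrace_mulC; by field.
Qed.

(** The form of [Y] at [(- X y, y)], [X] being the off-diagonal block, is the
    form of the Schur complement at [y]. *)
Lemma psd_defect_ursubmx (R : realType) (n p : nat) (Y : 'M[R]_(n + p)) :
  Y^T = Y -> ulsubmx Y = 1%:M -> drsubmx Y = 1%:M -> psd Y ->
  psd (defect (ursubmx Y)).
Proof.
move=> Ys Yul Ydr Yp y; set X := ursubmx Y.
have dl : dlsubmx Y = X^T by rewrite trmx_ursub Ys.
have := Yp (col_mx (- (X *m y)) y).
rewrite -[Y]submxK Yul Ydr dl -/X tr_col_mx mul_row_block mul_row_col.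
suff -> : (- (X *m y))^T *m 1%:M + y^T *m X^T = 0.
  rewrite mul0mx add0r /defect linearN /= trmx_mul mulNmx.
  by rewrite mulmx1 addrC mulmxBr mulmx1 !mulmxA.
by rewrite mulmx1 linearN /= trmx_mul addNr.
Qed.

(** On the manifold the block matrix is the Gram matrix
    [[1 X]^T [1 X]]. *)
Lemma psd_stiefel_block (R : realType) (n p : nat) (X : 'M[R]_(n, p)) :
  stiefel R n p X -> psd (block_mx 1%:M X X^T 1%:M).
Proof.
move=> XS x; have -> : block_mx 1%:M X X^T 1%:M =
    (row_mx 1%:M X)^T *m row_mx 1%:M X.
  by rewrite tr_row_mx mul_col_row trmx1 !mul1mx mulmx1 XS.
by rewrite mulmxA -trmx_mul -mulmxA dot_ge0.
Qed.

Theorem theorem4p2 (R : realType) (n p k : nat)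
    (hn : (1 <= n)%N) (hp : (1 <= p <= n)%N)
    (A0 : 'M[R]_(p, n)) (A : 'I_k -> 'M[R]_(p, n))
    (al au : 'I_k -> \bar R)
    (hal : forall i, al i <> (+oo)%E) (hau : forall i, au i <> (-oo)%E)
    (hpk : (p <= n - k)%N) :
  SDR_value A0 A al au = LPS_value A0 A al au.
Proof.
(* Truncated subtraction is harmless: [p > 0] forces [k < n]. *)
have hpkn : (p + k <= n)%N.
  case/andP: hp => p0 _; have kn : (k < n)%N.
    by rewrite -subn_gt0 (leq_trans p0 hpk).
  by rewrite -(subnK (ltnW kn)) leq_add2r.
apply/le_anti/andP; split; apply: le_ereal_inf_tmp.
- move=> _ [X [XS XA] <-]; set Y := block_mx 1%:M X X^T 1%:M.
  have Ys : Y^T = Y by rewrite tr_block_mx !trmx1 trmxK.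
  have YE B : \tr (lift_mx B *m Y) = \tr (B *m X).
    by rewrite lift_mx_trace // block_mxKur.
  apply: ereal_inf_lbound; exists Y; last by rewrite YE.
  split=> //; first by move=> i; rewrite YE.
  + by rewrite block_mxKul.
  + by rewrite block_mxKdr.
  + exact: psd_stiefel_block.
- move=> _ [Y [Ys YA Yul Ydr Yp] <-].
  have Mp := psd_defect_ursubmx Ys Yul Ydr Yp.
  have [X [XS XA XA0]] := contraction_to_stiefel A A0 hpkn Mp.
  rewrite lift_mx_trace //; apply: (@le_trans _ _ (\tr (A0 *m X))%:E).
    apply: ereal_inf_lbound; exists X => //; split=> // i.
    by rewrite XA -lift_mx_trace.
  by rewrite lee_fin.
Qed.
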